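(* (Double Cauchy's mean value theorem) Let $a,b\in\mathbb{R}^2$ satisfy $a<b$. Suppose that $f,g:[a,b]\to\mathbb{R}$ are double continuous functions on $[a,b]$ which are double differentiable on $(a,b)$. Then there exists $c\in(a,b)$ with $f'(c)\,\Delta_a^b(g)=g'(c)\,\Delta_a^b(f)$.
   Context: Points of $\mathbb{R}^2$ are written $a=(a_1,a_2)$. For $a,b\in\mathbb{R}^2$: $a<b$ means $a_1<b_1$ and $a_2<b_2$; $a\le b$ means $a_1\le b_1$ and $a_2\le b_2$; $a\nsim b$ means $a_1\ne b_1$ and $a_2\ne b_2$. $[a,b]=\{x\in\mathbb{R}^2: a\le x\le b\}$ and $(a,b)=\{x\in\mathbb{R}^2: a<x<b\}$. A double function is a real-valued function $f$ with domain $D(f)\subseteq\mathbb{R}^2$. The double difference is $\Delta_a^b(f)=f(b_1,b_2)-f(b_1,a_2)-f(a_1,b_2)+f(a_1,a_2)$ (whenever the four values are defined). Double continuity at a point: $f$ is double continuous at $a$ if there is a product $I=I_1\times I_2$ of open intervals with $a\in I\subseteq D(f)$ such that for all $x_1\in I_1$, $\lim_{x_2\to a_2}\Delta_a^{x}(f)=0$, and for all $x_2\in I_2$, $\lim_{x_1\to a_1}\Delta_a^{x}(f)=0$, where $x=(x_1,x_2)$. Signed double continuity: for $\delta=(\delta_1,\delta_2)$ with $\delta_1,\delta_2>0$, let $D_{++}(a,\delta)=[a_1,a_1+\delta_1)\times[a_2,a_2+\delta_2)$, $D_{+-}(a,\delta)=[a_1,a_1+\delta_1)\times(a_2-\delta_2,a_2]$,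 $D_{-+}(a,\delta)=(a_1-\delta_1,a_1]\times[a_2,a_2+\delta_2)$, $D_{--}(a,\delta)=(a_1-\delta_1,a_1]\times(a_2-\delta_2,a_2]$. For signs $\sigma,\tau\in\{+,-\}$, $f$ is $\sigma\tau$-double continuous at $a$ if there is such a $\delta$ with $I:=D_{\sigma\tau}(a,\delta)\subseteq D(f)$ such that for all $x_1\in I_1$, $\lim_{x_2\to a_2^{\tau}}\Delta_a^x(f)=0$ and for all $x_2\in I_2$, $\lim_{x_1\to a_1^{\sigma}}\Delta_a^x(f)=0$ (one-sided limits). $f$ is double continuous on $[a,b]$ if it is double continuous at each interior point of $[a,b]$ and, at each boundary point $p$ of $[a,b]$, it is $\sigma\tau$-double continuous for every sign pair $\sigma\tau$ such that $D_{\sigma\tau}(p,\delta)\subseteq[a,b]$ for some $\delta$. Double differentiability: for $a\nsim x$ put $m_a^x(f)=\Delta_a^x(f)/((x_1-a_1)(x_2-a_2))$. $f$ is double differentiable at $a$ if $D(f)$ contains a product of open intervals containing $a$ and there is a real number $f'(a)$ (the double derivative) such that for every $\epsilon>0$ there is $\delta=(\delta_1,\delta_2)$ with $\delta_1,\delta_2>0$ such that for all $x$ with $0<|x_1-a_1|<\delta_1$ and $0<|x_2-a_2|<\delta_2$, $m_a^x(f)$ is defined and $|m_a^x(f)-f'(a)|<\epsilon$. $f$ is double differentiable on $(a,b)$ if it is so at each point of $(a,b)$. *)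

(* Defs.v *)
(* Stdlib world: the classical reals R, with Coquelicot for limits. *)
From Stdlib Require Import Reals Lra.
From Coquelicot Require Import Coquelicot.
Open Scope R_scope.

Definition point : Type := (R * R)%type.

Definition plt (a b : point) : Prop := fst a < fst b /\ snd a < snd b.
Definition ple (a b : point) : Prop := fst a <= fst b /\ snd a <= snd b.
Definition nsim (a b : point) : Prop := fst a <> fst b /\ snd a <> snd b.

Definition closed_rect (a b x : point) : Prop := ple a x /\ ple x b.
Definition open_rect (a b x : point) : Prop := plt a x /\ plt x b.

(* The values of [dval] outside [dom] are junk: every notion below that
   evaluates a function also requires the points involved to lie in [dom]. *)
Record double_function : Type := DoubleFunction {
  dom : point -> Prop;
  dval :> point -> R
}.

Definition double_difference (f : double_function) (a b : point) : R :=
  f (fst b, snd b) - f (fst b, snd a) - f (fst a, snd b) + f (fst a, snd a).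

Definition double_difference_defined (f : double_function) (a b : point) : Prop :=
  dom f (fst b, snd b) /\ dom f (fst b, snd a) /\
  dom f (fst a, snd b) /\ dom f (fst a, snd a).

(* Possibly unbounded. *)
Definition open_interval (I : R -> Prop) : Prop :=
  exists l u : Rbar, forall x : R, I x <-> Rbar_lt l x /\ Rbar_lt x u.

(* [is_lim] is the limit over a punctured neighbourhood. *)
Definition double_continuous (f : double_function) (a : point) : Prop :=
  exists I1 I2 : R -> Prop,
    open_interval I1 /\ open_interval I2 /\
    I1 (fst a) /\ I2 (snd a) /\
    (forall x1 x2 : R, I1 x1 -> I2 x2 -> dom f (x1, x2)) /\
    (forall x1 : R, I1 x1 ->
       is_lim (fun x2 => double_difference f a (x1, x2)) (snd a) 0) /\
    (forall x2 : R, I2 x2 ->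
       is_lim (fun x1 => double_difference f a (x1, x2)) (fst a) 0).

Inductive side : Type := Plus | Minus.

Definition half_open (s : side) (p d x : R) : Prop :=
  match s with
  | Plus => p <= x < p + d
  | Minus => p - d < x <= p
  end.

Definition at_side (s : side) (p : R) : (R -> Prop) -> Prop :=
  match s with
  | Plus => at_right p
  | Minus => at_left p
  end.

Definition quadrant (s t : side) (a d x : point) : Prop :=
  half_open s (fst a) (fst d) (fst x) /\ half_open t (snd a) (snd d) (snd x).

Definition signed_double_continuous
    (s t : side) (f : double_function) (a : point) : Prop :=
  exists d : point,
    0 < fst d /\ 0 < snd d /\
    (forall x : point, quadrant s t a d x -> dom f x) /\
    (forall x1 : R, half_open s (fst a) (fst d) x1 ->
       filterlim (fun x2 => double_difference f a (x1, x2))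
         (at_side t (snd a)) (locally 0)) /\
    (forall x2 : R, half_open t (snd a) (snd d) x2 ->
       filterlim (fun x1 => double_difference f a (x1, x2))
         (at_side s (fst a)) (locally 0)).

Definition double_continuous_on (f : double_function) (a b : point) : Prop :=
  (forall p : point, open_rect a b p -> double_continuous f p) /\
  (forall p : point, closed_rect a b p -> ~ open_rect a b p ->
     forall s t : side,
       (exists d : point, 0 < fst d /\ 0 < snd d /\
          forall x : point, quadrant s t p d x -> closed_rect a b x) ->
       signed_double_continuous s t f p).

Definition double_quotient (f : double_function) (a x : point) : R :=
  double_difference f a x / ((fst x - fst a) * (snd x - snd a)).

Definition double_quotient_defined (f : double_function) (a x : point) : Prop :=
  nsim a x /\ double_difference_defined f a x.

Definition is_double_derivative
    (f : double_function) (a : point) (l : R) : Prop :=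
  (exists I1 I2 : R -> Prop,
     open_interval I1 /\ open_interval I2 /\
     I1 (fst a) /\ I2 (snd a) /\
     (forall x1 x2 : R, I1 x1 -> I2 x2 -> dom f (x1, x2))) /\
  (forall eps : R, 0 < eps ->
     exists d : point, 0 < fst d /\ 0 < snd d /\
       forall x : point,
         0 < Rabs (fst x - fst a) < fst d ->
         0 < Rabs (snd x - snd a) < snd d ->
         double_quotient_defined f a x /\
         Rabs (double_quotient f a x - l) < eps).

Definition double_differentiable (f : double_function) (a : point) : Prop :=
  exists l : R, is_double_derivative f a l.

Definition double_differentiable_on (f : double_function) (a b : point) : Prop :=
  forall p : point, open_rect a b p -> double_differentiable f p.

(* Meaningful only where [f] is double differentiable; there it is the unique
   number satisfying [is_double_derivative], by [double_derivative_correct]. *)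
Definition double_derivative (f : double_function) (a : point) : R :=
  iota (fun l : R => is_double_derivative f a l).

Lemma is_double_derivative_inj (f : double_function) (a : point) (l l' : R) :
  is_double_derivative f a l -> is_double_derivative f a l' -> l = l'.
Proof.
intros [_ H] [_ H'].
destruct (Req_dec l l') as [E | E]; [exact E | exfalso].
assert (He : 0 < Rabs (l - l') / 2).
{ assert (0 < Rabs (l - l')) by (apply Rabs_pos_lt; lra). lra. }
destruct (H _ He) as [d [d1 [d2 Hd]]].
destruct (H' _ He) as [e [e1 [e2 He']]].
set (h := Rmin (fst d) (fst e) / 2).
set (k := Rmin (snd d) (snd e) / 2).
assert (Hh : 0 < h /\ h < fst d /\ h < fst e).
{ unfold h, Rmin; destruct (Rle_dec (fst d) (fst e)); lra. }
assert (Hk : 0 < k /\ k < snd d /\ k < snd e).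
{ unfold k, Rmin; destruct (Rle_dec (snd d) (snd e)); lra. }
assert (Eh : Rabs (fst a + h - fst a) = h).
{ replace (fst a + h - fst a) with h by ring. apply Rabs_pos_eq; lra. }
assert (Ek : Rabs (snd a + k - snd a) = k).
{ replace (snd a + k - snd a) with k by ring. apply Rabs_pos_eq; lra. }
destruct (Hd (fst a + h, snd a + k)) as [_ Q];
  [cbn [fst snd]; lra | cbn [fst snd]; lra |].
destruct (He' (fst a + h, snd a + k)) as [_ Q'];
  [cbn [fst snd]; lra | cbn [fst snd]; lra |].
set (m := double_quotient f a _) in Q, Q'.
rewrite Rabs_minus_sym in Q.
pose proof (Rabs_triang (l - m) (m - l')) as T.
replace (l - m + (m - l')) with (l - l') in T by ring.
lra.
Qed.

Lemma double_derivative_correct (f : double_function) (a : point) :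
  double_differentiable f a ->
  is_double_derivative f a (double_derivative f a).
Proof.
intros [l Hl].
apply (iota_correct (fun l : R => is_double_derivative f a l)).
exists l; split; [exact Hl |].
intros l' Hl'; exact (is_double_derivative_inj f a l l' Hl Hl').
Qed.

(* Main.v *)
(** Bögel's argument.  With [h = Δ(g) f - Δ(f) g] one has [Δ_a^b(h) = 0].  Double
    continuity, which is local, makes every increment [h(.,y') - h(.,y)] continuous
    on the whole side of the rectangle, so the intermediate value theorem, applied in
    one coordinate after the other, produces a strictly interior rectangle with sides
    three times shorter on which the double difference of [h] is again zero.
    Iterating, the rectangles shrink to a point [c]; since the double difference
    over a rectangle around [c] is a signed sum of four double differences
    based at [c], its quotient by the area tends to [h'(c)], which is therefore [0]. *)
Require Import Defs.
From Stdlib Require Import Reals Lra.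
From Coquelicot Require Import Coquelicot.
From Stdlib Require Import IndefiniteDescription.
Open Scope R_scope.

(** * From local to global relations on an interval *)

(** For [x] in [[a, b]], a short segment on side [s] of [x] stays in the interval; at an endpoint
    only the inward side qualifies. *)
Definition side_available (s : side) (a b x : R) : Prop :=
  match s with
  | Plus => x < b
  | Minus => a < x
  end.

(** A connectedness argument: let [m] be the supremum of the points up to which everything is
    related to [a]. The relation to the left of [m] reaches [m] itself, and the one to its right
    passes beyond [m] unless [m = b]. *)
Lemma interval_chain (a b : R) (E : R -> R -> Prop) :
  (forall y, E y y) ->
  (forall y z, E y z -> E z y) ->
  (forall x y z, E x y -> E y z -> E x z) ->
  (forall y t, a <= y <= b -> side_available t a b y ->
     exists d, 0 < d /\ forall z, half_open t y d z -> E y z) ->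
  forall y z, a <= y <= b -> a <= z <= b -> E y z.
Proof.
intros refl sym trans loc.
assert (base : forall y, a <= y <= b -> E a y).
{ intros y hy.
  set (S := fun z => a <= z <= b /\ forall w, a <= w <= z -> E a w).
  destruct (completeness S) as [m [ub lub]].
  { exists b; intros z [hz _]; lra. }
  { exists a; split; [lra |]. intros w hw; replace w with a by lra; apply refl. }
  assert (Sa : S a).
  { split; [lra |]. intros w hw; replace w with a by lra; apply refl. }
  assert (am : a <= m) by (apply ub, Sa).
  assert (mb : m <= b) by (apply lub; intros z [hz _]; lra).
  assert (near : forall u, u < m -> exists z, S z /\ u < z).
  { intros u hu. apply Classical_Prop.NNPP; intros no.
    assert (m <= u); [| lra].
    apply lub; intros z hz. apply Rnot_lt_le; intros huz. apply no; now exists z. }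
  assert (Em : E a m).
  { destruct (Req_dec a m) as [<- | am']; [apply refl |].
    destruct (loc m Minus) as [d [hd Hd]]; [lra | simpl; lra |].
    destruct (near (m - d)) as [z [hz hz']]; [lra |].
    assert (z <= m) by (apply ub, hz).
    apply (trans a z); [apply hz; destruct hz; lra |].
    apply sym, Hd; simpl; lra. }
  assert (below : forall w, a <= w <= m -> E a w).
  { intros w hw. destruct (Req_dec w m) as [-> | wm]; [exact Em |].
    destruct (near w) as [z [hz hz']]; [lra |].
    apply hz; lra. }
  destruct (Req_dec m b) as [-> | mb']; [apply below; lra |].
  exfalso.
  destruct (loc m Plus) as [d [hd Hd]]; [lra | simpl; lra |].
  (* Half of [d] keeps [z] strictly inside the half-open segment; [z] then lies in [S] beyond its
     upper bound [m]. *)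
  set (z := Rmin b (m + d / 2)).
  assert (hz : m < z /\ z <= b /\ z < m + d).
  { unfold z, Rmin; destruct (Rle_dec b (m + d / 2)); lra. }
  assert (z <= m); [| lra].
  apply ub; split; [lra |].
  intros w hw. destruct (Rle_dec w m); [apply below; lra |].
  apply (trans a m); [exact Em |]. apply Hd; simpl; lra. }
intros y z hy hz.
apply (trans y a); [apply sym |]; now apply base.
Qed.

(** * Continuity of increments *)

Definition in_interval (a b x : R) : Prop := a <= x <= b.

(** Continuity relative to [[a, b]], since values of a double function outside its domain are
    junk. *)
Definition continuous_on_interval (phi : R -> R) (a b : R) : Prop :=
  forall x, a <= x <= b ->
    filterlim phi (within (in_interval a b) (locally x)) (locally (phi x)).

#[local] Instance at_side_filter (s : side) (x : R) : ProperFilter (at_side s x).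
Proof. destruct s; simpl; typeclasses eauto. Qed.

Lemma one_sided_continuous_on_interval (phi : R -> R) (a b : R) :
  (forall x s, a <= x <= b -> side_available s a b x ->
     filterlim phi (at_side s x) (locally (phi x))) ->
  continuous_on_interval phi a b.
Proof.
intros H x hx P HP.
assert (L : a < x -> at_left x (fun z => P (phi z))).
{ intros ax; exact (H x Minus hx ax P HP). }
assert (R : x < b -> at_right x (fun z => P (phi z))).
{ intros xb; exact (H x Plus hx xb P HP). }
(* At an endpoint the outward side contains no point of [[a, b]], so the claim there is vacuous. *)
assert (L' : locally x (fun z => a <= z -> z < x -> P (phi z))).
{ destruct (Rlt_dec a x) as [ax | ax].
  - apply (filter_imp (F := locally x)) with (2 := L ax); auto.
  - apply filter_forall; intros; lra. }
assert (R' : locally x (fun z => z <= b -> x < z -> P (phi z))).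
{ destruct (Rlt_dec x b) as [xb | xb].
  - apply (filter_imp (F := locally x)) with (2 := R xb); auto.
  - apply filter_forall; intros; lra. }
unfold filtermap, within.
generalize (filter_and _ _ L' R'); apply filter_imp; intros z [Hl Hr] [az zb].
destruct (Rtotal_order z x) as [zx | [-> | zx]]; auto.
now apply locally_singleton.
Qed.

(** Fix [x] and the side [s]. That the increment between [y] and [y'] has its one-sided limit at [x]
    is an equivalence relation in [y] and [y'], because limits can be negated and added. The
    hypothesis says that it holds locally, so [interval_chain] spreads it over [[a2, b2]]. *)
Lemma increment_continuous (F : R -> R -> R) (a1 b1 a2 b2 : R) :
  (forall x y s t, a1 <= x <= b1 -> a2 <= y <= b2 ->
     side_available s a1 b1 x -> side_available t a2 b2 y ->
     exists d, 0 < d /\ forall y', half_open t y d y' ->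
       filterlim (fun x' => F x' y' - F x' y - F x y' + F x y)
         (at_side s x) (locally 0)) ->
  forall y y', a2 <= y <= b2 -> a2 <= y' <= b2 ->
  continuous_on_interval (fun x => F x y' - F x y) a1 b1.
Proof.
intros H y y' hy hy'.
apply one_sided_continuous_on_interval; intros x s hx hs.
set (E := fun y y' => filterlim (fun x' => F x' y' - F x' y)
                        (at_side s x) (locally (F x y' - F x y))).
change (E y y').
apply (interval_chain a2 b2); [ | | | | exact hy | exact hy']; clear y y' hy hy'.
- intros y. unfold E.
  apply filterlim_ext with (fun _ => F x y - F x y); [intros; ring |].
  apply filterlim_const.
- intros y z Hyz; unfold E.
  apply filterlim_ext with (fun x' => opp (F x' z - F x' y)).
  { intros; unfold opp; simpl; ring. }
  replace (F x y - F x z) with (opp (F x z - F x y)) by (unfold opp; simpl; ring).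
  exact (filterlim_comp _ _ _ _ _ _ _ _ Hyz (filterlim_opp _)).
- intros y z w Hyz Hzw; unfold E.
  apply filterlim_ext with (fun x' => plus (F x' z - F x' y) (F x' w - F x' z)).
  { intros; unfold plus; simpl; ring. }
  replace (F x w - F x y) with (plus (F x z - F x y) (F x w - F x z))
    by (unfold plus; simpl; ring).
  exact (filterlim_comp_2 _ _ _ Hyz Hzw (filterlim_plus _ _)).
- intros y t hy ht.
  destruct (H x y s t hx hy hs ht) as [d [hd Hd]].
  exists d; split; [exact hd |]. intros z hz.
  specialize (Hd z hz). unfold E.
  apply filterlim_ext with
    (fun x' => plus (F x' z - F x' y - F x z + F x y) (F x z - F x y)).
  { intros; unfold plus; simpl; ring. }
  replace (locally (F x z - F x y)) with (locally (plus 0 (F x z - F x y)))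
    by (f_equal; apply Rplus_0_l).
  exact (filterlim_comp_2 _ _ _ Hd (filterlim_const _) (filterlim_plus _ _)).
Qed.

(** * One-sided limits from double continuity on a rectangle *)

Lemma open_interval_half_open (I : R -> Prop) (x : R) (s : side) :
  Defs.open_interval I -> I x -> exists d, 0 < d /\ forall z, half_open s x d z -> I z.
Proof.
intros [l [u H]] hx. apply H in hx.
destruct (@locally_interval I x l u) as [d Hd]; [apply hx | apply hx | |].
{ now intros; apply H. }
exists d; split; [apply cond_pos |].
intros z hz; apply Hd, Rabs_lt_between.
unfold minus, plus, opp; destruct s; simpl in *; lra.
Qed.

Lemma is_lim_at_side (phi : R -> R) (x l : R) (s : side) :
  is_lim phi x l -> filterlim phi (at_side s x) (locally l).
Proof.
intros H P HP. specialize (H P HP).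
unfold filtermap in *; simpl in *; unfold locally' in H.
destruct s; apply (filter_imp (F := locally x)) with (2 := H);
  intros z Hz hz; apply Hz; lra.
Qed.

Lemma half_open_within (s : side) (a b x : R) :
  a <= x <= b -> side_available s a b x ->
  exists d, 0 < d /\ forall z, half_open s x d z -> a <= z <= b.
Proof.
intros hx hs; destruct s; simpl in *.
- exists (b - x); split; [lra | intros; lra].
- exists (x - a); split; [lra | intros; lra].
Qed.

(** Treats interior and boundary points alike: inside, full limits restrict to each side; on the
    boundary, two available sides give a quadrant that fits in the rectangle, which is where signed
    double continuity is assumed. *)
Lemma one_sided_double_limits (f : double_function) (a b : point)
    (x y : R) (s t : side) :
  double_continuous_on f a b ->
  fst a <= x <= fst b -> snd a <= y <= snd b ->
  side_available s (fst a) (fst b) x -> side_available t (snd a) (snd b) y ->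
  (exists d, 0 < d /\ forall y', half_open t y d y' ->
     filterlim (fun x' => double_difference f (x, y) (x', y'))
       (at_side s x) (locally 0)) /\
  (exists d, 0 < d /\ forall x', half_open s x d x' ->
     filterlim (fun y' => double_difference f (x, y) (x', y'))
       (at_side t y) (locally 0)).
Proof.
intros [Hin Hbd] hx hy hs ht.
destruct (Classical_Prop.classic (open_rect a b (x, y))) as [hp | hp].
- destruct (Hin _ hp) as [I1 [I2 [O1 [O2 [M1 [M2 [_ [L2 L1]]]]]]]].
  destruct (open_interval_half_open _ _ s O1 M1) as [d1 [hd1 H1]].
  destruct (open_interval_half_open _ _ t O2 M2) as [d2 [hd2 H2]].
  split.
  + exists d2; split; [exact hd2 |]. intros y' hy'.
    now apply is_lim_at_side, L1, H2.
  + exists d1; split; [exact hd1 |]. intros x' hx'.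
    now apply is_lim_at_side, L2, H1.
- assert (hc : closed_rect a b (x, y)) by (unfold closed_rect, ple; simpl; lra).
  destruct (Hbd _ hc hp s t) as [d [hd1 [hd2 [_ [L2 L1]]]]].
  { destruct (half_open_within s _ _ _ hx hs) as [d1 [hd1 H1]].
    destruct (half_open_within t _ _ _ hy ht) as [d2 [hd2 H2]].
    exists (d1, d2); split; [exact hd1 | split; [exact hd2 |]].
    intros z [hz1 hz2]. apply H1 in hz1; apply H2 in hz2.
    unfold closed_rect, ple; lra. }
  split; [exists (snd d) | exists (fst d)]; auto.
Qed.

Lemma horizontal_increment_continuous (f : double_function) (a b : point) (y y' : R) :
  double_continuous_on f a b ->
  snd a <= y <= snd b -> snd a <= y' <= snd b ->
  continuous_on_interval (fun x => f (x, y') - f (x, y)) (fst a) (fst b).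
Proof.
intros Hf. apply (increment_continuous (fun x y => f (x, y))).
intros x z s t hx hz hs ht.
exact (proj1 (one_sided_double_limits f a b x z s t Hf hx hz hs ht)).
Qed.

Lemma vertical_increment_continuous (f : double_function) (a b : point) (x x' : R) :
  double_continuous_on f a b ->
  fst a <= x <= fst b -> fst a <= x' <= fst b ->
  continuous_on_interval (fun y => f (x', y) - f (x, y)) (snd a) (snd b).
Proof.
intros Hf. apply (increment_continuous (fun y x => f (x, y))).
intros y z t s hy hz ht hs.
destruct (proj2 (one_sided_double_limits f a b z y s t Hf hz hy hs ht)) as [d [hd Hd]].
exists d; split; [exact hd |]. intros z' hz'.
(* Exchanging the coordinates only swaps the two subtracted terms of the double difference. *)
apply filterlim_ext with (2 := Hd z' hz').
intros w; unfold double_difference; simpl; ring.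
Qed.

(** * Shrinking a rectangle of zero double difference *)

Lemma continuous_on_interval_lincomb (phi psi : R -> R) (k l a b : R) :
  continuous_on_interval phi a b -> continuous_on_interval psi a b ->
  continuous_on_interval (fun x => k * phi x - l * psi x) a b.
Proof.
intros Hphi Hpsi x hx.
apply filterlim_ext with (fun z => plus (scal k (phi z)) (scal (- l) (psi z))).
{ intros; unfold plus, scal; simpl; unfold mult; simpl; ring. }
replace (k * phi x - l * psi x) with (plus (scal k (phi x)) (scal (- l) (psi x)))
  by (unfold plus, scal; simpl; unfold mult; simpl; ring).
refine (filterlim_comp_2 _ _ _ _ _ (filterlim_plus _ _)).
- exact (filterlim_comp _ _ _ _ _ _ _ _ (Hphi x hx) (filterlim_scal_r _ _)).
- exact (filterlim_comp _ _ _ _ _ _ _ _ (Hpsi x hx) (filterlim_scal_r _ _)).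
Qed.

Lemma continuous_on_subinterval (phi : R -> R) (a b a' b' : R) :
  a <= a' -> b' <= b ->
  continuous_on_interval phi a b -> continuous_on_interval phi a' b'.
Proof.
intros ha hb H x hx P HP.
generalize (H x ltac:(lra) P HP); unfold filtermap, within, in_interval.
apply filter_imp; intros z Hz hz; apply Hz; lra.
Qed.

(** [IVT_cor] asks for continuity on the whole line, so [phi] is composed with the retraction
    [clamp] onto [[a, b]], which is 1-Lipschitz. *)
Lemma IVT_on_interval (phi : R -> R) (a b : R) :
  a <= b -> continuous_on_interval phi a b -> phi a * phi b <= 0 ->
  exists x, a <= x <= b /\ phi x = 0.
Proof.
intros hab H hs.
set (clamp := fun x => Rmax a (Rmin b x)).
assert (clamp_in : forall x, a <= clamp x <= b).
{ intros x; unfold clamp, Rmax, Rmin.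
  destruct (Rle_dec b x), (Rle_dec a _); lra. }
assert (clamp_id : forall x, a <= x <= b -> clamp x = x).
{ intros x hx; unfold clamp, Rmax, Rmin.
  destruct (Rle_dec b x), (Rle_dec a _); lra. }
assert (clamp_lip : forall x y, Rabs (clamp y - clamp x) <= Rabs (y - x)).
{ intros x y; unfold clamp, Rmax, Rmin, Rabs.
  destruct (Rle_dec b x), (Rle_dec b y);
  repeat match goal with
  | |- context [Rle_dec ?u ?v] => destruct (Rle_dec u v)
  | |- context [Rcase_abs ?u] => destruct (Rcase_abs u)
  end; lra. }
assert (C : continuity (fun x => phi (clamp x))).
{ intros x. apply continuity_pt_filterlim.
  intros P HP. generalize (H (clamp x) (clamp_in x) P HP).
  unfold filtermap, within; intros [d Hd]; exists d; intros y hy.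
  apply Hd; [| apply clamp_in].
  exact (Rle_lt_trans _ _ _ (clamp_lip x y) hy). }
destruct (IVT_cor _ a b C hab) as [x [hx Hx]].
{ now rewrite !clamp_id by lra. }
exists x; split; [exact hx |]. now rewrite clamp_id in Hx.
Qed.

(* The three increments over the thirds of [a, b] add up to zero: either the middle
   one vanishes, or it has the sign opposite to that of one of the other two. *)
Lemma interior_zero_increment (phi : R -> R) (a b : R) :
  a < b -> continuous_on_interval phi a b -> phi a = phi b ->
  exists a' b', a < a' /\ a' < b' /\ b' < b /\ b' - a' = (b - a) / 3 /\ phi a' = phi b'.
Proof.
intros hab H hphi.
set (l := (b - a) / 3).
assert (hl : 0 < l) by (unfold l; lra).
assert (hb : b = a + l + l + l) by (unfold l; lra).
set (psi := fun x => phi (x + l) - phi x).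
assert (C : continuous_on_interval psi a (a + l + l)).
{ intros x hx.
  apply filterlim_ext with (fun z => plus (phi (z + l)) (opp (phi z))); [reflexivity |].
  change (psi x) with (plus (phi (x + l)) (opp (phi x))).
  refine (filterlim_comp_2 _ _ _ _ _ (filterlim_plus _ _)).
  - intros P HP. destruct (H (x + l) ltac:(lra) P HP) as [d Hd].
    exists d; intros y hy hy'. apply Hd; [| unfold in_interval in *; lra].
    unfold ball in *; simpl in *; unfold AbsRing_ball, abs, minus, plus, opp in *.
    simpl in *. now replace (y + l + - (x + l)) with (y + - x) by ring.
  - refine (filterlim_comp _ _ _ _ _ _ _ _ _ (filterlim_opp _)).
    apply (continuous_on_subinterval phi a b); [lra | lra | exact H | exact hx]. }
assert (sum : psi a + psi (a + l) + psi (a + l + l) = 0).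
{ unfold psi; rewrite <- hb; lra. }
assert (zero : exists x, a < x < a + l + l /\ psi x = 0).
{ destruct (Req_dec (psi (a + l)) 0) as [z | nz]; [exists (a + l); lra |].
  destruct (Rlt_dec (psi a * psi (a + l)) 0) as [neg | neg].
  - destruct (IVT_on_interval psi a (a + l)) as [x [hx Hx]]; [lra | | lra |].
    { apply (continuous_on_subinterval psi a (a + l + l)); auto; lra. }
    exists x; split; [| exact Hx].
    (* A sign change excludes zeros at the ends of the subinterval, which makes the new interval
       strictly interior. *)
    assert (x <> a) by (intros ->; rewrite Hx in neg; lra). lra.
  - assert (neg' : psi (a + l) * psi (a + l + l) < 0).
    (* The product equals [- psi a * psi (a + l)], which is at most zero here, minus a positive
       square. *)
    { replace (psi (a + l + l)) with (- psi a - psi (a + l)) by lra.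
      assert (0 < Rsqr (psi (a + l))) by now apply Rlt_0_sqr.
      unfold Rsqr in *; lra. }
    destruct (IVT_on_interval psi (a + l) (a + l + l)) as [x [hx Hx]]; [lra | | lra |].
    { apply (continuous_on_subinterval psi a (a + l + l)); auto; lra. }
    exists x; split; [| exact Hx].
    assert (x <> a + l + l) by (intros ->; rewrite Hx in neg'; lra). lra. }
destruct zero as [x [hx Hx]].
exists x, (x + l). unfold psi in Hx. repeat split; lra.
Qed.

(** The double difference of [h = k f - l g], written out without forming [h] as a double
    function. *)
Definition combined_difference (f g : double_function) (k l : R) (p q : point) : R :=
  k * double_difference f p q - l * double_difference g p q.

(** A zero double difference means that the increment of [h] across the height agrees at both
    abscissas, so the horizontal side can be cut to a third, and then the vertical one. Continuity
    is always inherited from the outer rectangle. *)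
Lemma interior_zero_double_difference (f g : double_function) (k l : R) (a b p q : point) :
  double_continuous_on f a b -> double_continuous_on g a b ->
  ple a p -> ple q b -> plt p q -> combined_difference f g k l p q = 0 ->
  exists p' q', plt p p' /\ plt p' q' /\ plt q' q /\
    fst q' - fst p' = (fst q - fst p) / 3 /\ snd q' - snd p' = (snd q - snd p) / 3 /\
    combined_difference f g k l p' q' = 0.
Proof.
destruct p as [p1 p2], q as [q1 q2].
intros Hf Hg [ap1 ap2] [qb1 qb2] [pq1 pq2] Z; simpl in *.
unfold combined_difference, double_difference in Z; simpl in Z.
destruct (interior_zero_increment
  (fun x => k * (f (x, q2) - f (x, p2)) - l * (g (x, q2) - g (x, p2))) p1 q1)
  as [p1' [q1' [h1 [h2 [h3 [h4 h5]]]]]]; [lra | | lra |].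
{ apply (continuous_on_subinterval _ (fst a) (fst b)); [lra | lra |].
  apply continuous_on_interval_lincomb; apply horizontal_increment_continuous;
    auto; lra. }
(* [h5] says exactly that the increment between the new abscissas agrees at [p2] and [q2]. *)
destruct (interior_zero_increment
  (fun y => k * (f (q1', y) - f (p1', y)) - l * (g (q1', y) - g (p1', y))) p2 q2)
  as [p2' [q2' [v1 [v2 [v3 [v4 v5]]]]]]; [lra | | lra |].
{ apply (continuous_on_subinterval _ (snd a) (snd b)); [lra | lra |].
  apply continuous_on_interval_lincomb; apply vertical_increment_continuous;
    auto; lra. }
exists (p1', p2'), (q1', q2').
unfold plt, combined_difference, double_difference; simpl; repeat split; lra.
Qed.

(** * Nested intervals and rectangles *)

(** Take the supremum of the left ends; it is strictly inside each interval because it lies in the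
    closure of the next one. *)
Lemma nested_intervals (u v : nat -> R) :
  (forall n, u n < u (S n)) -> (forall n, v (S n) < v n) -> (forall n, u n < v n) ->
  exists c, forall n, u n < c < v n.
Proof.
intros hu hv huv.
assert (incr : forall m n, (m <= n)%nat -> u m <= u n /\ v n <= v m).
{ intros m n mn; induction mn as [| n mn IH]; [lra |].
  specialize (hu n); specialize (hv n); lra. }
assert (cross : forall m n, u m < v n).
{ intros m n. specialize (huv (max m n)).
  destruct (incr m (max m n)); [apply Nat.le_max_l |].
  destruct (incr n (max m n)); [apply Nat.le_max_r | lra]. }
destruct (completeness (fun x => exists n, x = u n)) as [c [ub lub]].
{ exists (v 0%nat); intros x [n ->]; apply Rlt_le, cross. }
{ now exists (u 0%nat), 0%nat. }
exists c; intros n; split.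
- apply Rlt_le_trans with (1 := hu n), ub; now exists (S n).
- apply Rle_lt_trans with (2 := hv n), lub; intros x [m ->]; apply Rlt_le, cross.
Qed.

Lemma nested_rectangles (P : point -> point -> Prop) (a b : point) :
  plt a b -> P a b ->
  (forall p q, plt p q -> ple a p -> ple q b -> P p q ->
     exists p' q', plt p p' /\ plt p' q' /\ plt q' q /\
       fst q' - fst p' = (fst q - fst p) / 3 /\ snd q' - snd p' = (snd q - snd p) / 3 /\
       P p' q') ->
  exists c, open_rect a b c /\
    forall d, 0 < d -> exists p q, open_rect p q c /\ P p q /\
      fst q - fst p < d /\ snd q - snd p < d.
Proof.
intros hab Pab step.
set (good := fun r : point * point =>
  plt (fst r) (snd r) /\ ple a (fst r) /\ ple (snd r) b /\ P (fst r) (snd r)).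
(* Guarding the relation by [good r] makes it total, as choice requires; a rectangle that is not
   good is sent to itself. *)
destruct (functional_choice (fun r r' : point * point => good r ->
  good r' /\ plt (fst r) (fst r') /\ plt (snd r') (snd r) /\
  fst (snd r') - fst (fst r') = (fst (snd r) - fst (fst r)) / 3 /\
  snd (snd r') - snd (fst r') = (snd (snd r) - snd (fst r)) / 3)) as [next Hnext].
{ intros [p q].
  destruct (Classical_Prop.classic (good (p, q))) as [[h1 [h2 [h3 h4]]] | ng];
    [| exists (p, q); tauto].
  destruct (step p q h1 h2 h3 h4) as [p' [q' [k1 [k2 [k3 [k4 [k5 k6]]]]]]].
  exists (p', q'); intros _. unfold good, plt, ple in *; simpl in *.
  repeat split; try exact k6; lra. }
set (r := fun n => Nat.iter n next (a, b)).
assert (G : forall n, good (r n)).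
{ induction n as [| n IH]; [| exact (proj1 (Hnext _ IH))].
  unfold good, ple, r; simpl; repeat split; try apply hab; try lra; exact Pab. }
assert (N : forall n, _) by exact (fun n => proj2 (Hnext _ (G n))).
destruct (nested_intervals (fun n => fst (fst (r n))) (fun n => fst (snd (r n))))
  as [c1 H1]; [apply N | apply N | apply G |].
destruct (nested_intervals (fun n => snd (fst (r n))) (fun n => snd (snd (r n))))
  as [c2 H2]; [apply N | apply N | apply G |].
assert (O : forall n, open_rect (fst (r n)) (snd (r n)) (c1, c2)).
{ intros n; specialize (H1 n); specialize (H2 n).
  unfold open_rect, plt; simpl in *; lra. }
exists (c1, c2); split; [exact (O 0%nat) |].
assert (W : forall n,
  fst (snd (r n)) - fst (fst (r n)) = (fst b - fst a) * (/ 3) ^ n /\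
  snd (snd (r n)) - snd (fst (r n)) = (snd b - snd a) * (/ 3) ^ n).
{ induction n as [| n [IH1 IH2]]; [simpl; lra |].
  destruct (N n) as [_ [_ [E1 E2]]].
  change (next (r n)) with (r (S n)) in E1, E2.
  rewrite E1, E2, IH1, IH2; simpl; split; field. }
intros d hd.
(* [w] dominates both sides of the outer rectangle, so [(/ 3) ^ n < d / w] makes both sides of the
   [n]-th one shorter than [d]. *)
set (w := fst b - fst a + (snd b - snd a)).
assert (hw : 0 < fst b - fst a /\ 0 < snd b - snd a) by (unfold plt in hab; lra).
destruct (pow_lt_1_zero (/ 3) ltac:(rewrite Rabs_pos_eq; lra) (d / w)) as [n Hn].
{ apply Rdiv_lt_0_compat; unfold w; lra. }
specialize (Hn n (le_n n)).
assert (hp : 0 < (/ 3) ^ n) by (apply pow_lt; lra).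
rewrite Rabs_pos_eq in Hn by lra.
apply (Rmult_lt_compat_r w) in Hn; [| unfold w; lra].
replace (d / w * w) with d in Hn by (field; unfold w; lra).
exists (fst (r n)), (snd (r n)).
split; [apply O | split; [apply G |]].
destruct (W n) as [-> ->]. unfold w in Hn.
assert (0 < (fst b - fst a) * (/ 3) ^ n) by (apply Rmult_lt_0_compat; lra).
assert (0 < (snd b - snd a) * (/ 3) ^ n) by (apply Rmult_lt_0_compat; lra).
lra.
Qed.

(** * Linear approximation of double differences *)

(** Multiplying the quotient estimate by the area gives errors that can be added. If [x] shares a
    coordinate with [c], both sides vanish. *)
Lemma double_difference_corner_estimate (f : double_function) (c : point) (l eps : R) :
  is_double_derivative f c l -> 0 < eps ->
  exists d, 0 < d /\ forall x,
    Rabs (fst x - fst c) < d -> Rabs (snd x - snd c) < d ->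
    Rabs (double_difference f c x - l * ((fst x - fst c) * (snd x - snd c)))
    <= eps * (Rabs (fst x - fst c) * Rabs (snd x - snd c)).
Proof.
intros [_ H] he. destruct (H eps he) as [[d1 d2] [hd1 [hd2 Hd]]]; simpl in *.
exists (Rmin d1 d2); split; [now apply Rmin_glb_lt |].
intros [x y] hx hy; simpl in *. specialize (Hd (x, y)); simpl in Hd.
assert (Rmin d1 d2 <= d1) by apply Rmin_l. assert (Rmin d1 d2 <= d2) by apply Rmin_r.
destruct (Req_dec x (fst c)) as [-> | nx].
{ replace (_ - _) with 0 by (unfold double_difference; simpl; ring).
  rewrite Rminus_diag, Rabs_R0; lra. }
destruct (Req_dec y (snd c)) as [-> | ny].
{ replace (_ - l * _) with 0 by (unfold double_difference; simpl; ring).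
  rewrite Rminus_diag, Rabs_R0; lra. }
assert (0 < Rabs (x - fst c)) by (apply Rabs_pos_lt; lra).
assert (0 < Rabs (y - snd c)) by (apply Rabs_pos_lt; lra).
destruct Hd as [_ Hd]; [lra | lra |].
unfold double_quotient in Hd; simpl in Hd.
rewrite <- Rabs_mult.
set (m := (x - fst c) * (y - snd c)) in *.
assert (nm : m <> 0) by (apply Rmult_integral_contrapositive; lra).
replace (double_difference f c (x, y) - l * m)
  with ((double_difference f c (x, y) / m - l) * m) by (field; exact nm).
rewrite Rabs_mult. apply Rmult_le_compat_r; [apply Rabs_pos | lra].
Qed.

(** The point [c] cuts the rectangle into four with a corner at [c]. The double differences from [c]
    to the four corners, with signs plus at [p] and [q] and minus at the mixed corners, sum to the
    one over the rectangle; the signed products and the absolute areas both sum to its area. *)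
Lemma double_difference_straddle_estimate (f : double_function) (c : point) (l eps : R) :
  is_double_derivative f c l -> 0 < eps ->
  exists d, 0 < d /\ forall p q, open_rect p q c ->
    fst q - fst p < d -> snd q - snd p < d ->
    Rabs (double_difference f p q - l * ((fst q - fst p) * (snd q - snd p)))
    <= eps * ((fst q - fst p) * (snd q - snd p)).
Proof.
intros Hl he.
destruct (double_difference_corner_estimate f c l eps Hl he) as [d [hd H]].
exists d; split; [exact hd |].
intros [p1 p2] [q1 q2] [[pc1 pc2] [cq1 cq2]] w1 w2; simpl in *.
assert (Ap1 : Rabs (p1 - fst c) = fst c - p1) by (rewrite Rabs_left; lra).
assert (Ap2 : Rabs (p2 - snd c) = snd c - p2) by (rewrite Rabs_left; lra).
assert (Aq1 : Rabs (q1 - fst c) = q1 - fst c) by (rewrite Rabs_pos_eq; lra).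
assert (Aq2 : Rabs (q2 - snd c) = q2 - snd c) by (rewrite Rabs_pos_eq; lra).
assert (Hpp := H (p1, p2)); assert (Hpq := H (p1, q2)).
assert (Hqp := H (q1, p2)); assert (Hqq := H (q1, q2)).
simpl in *. rewrite Ap1, Ap2 in Hpp. rewrite Ap1, Aq2 in Hpq.
rewrite Aq1, Ap2 in Hqp. rewrite Aq1, Aq2 in Hqq.
apply Rabs_le_between in Hpp; [| lra | lra].
apply Rabs_le_between in Hpq; [| lra | lra].
apply Rabs_le_between in Hqp; [| lra | lra].
apply Rabs_le_between in Hqq; [| lra | lra].
apply Rabs_le_between.
unfold double_difference in *; simpl in *; lra.
Qed.

(** * The limit argument at the common point *)

Theorem proposition19 (a b : point) (f g : double_function)
    (hab : plt a b)
    (hDf : forall x : point, dom f x <-> closed_rect a b x)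
    (hDg : forall x : point, dom g x <-> closed_rect a b x)
    (hfc : double_continuous_on f a b)
    (hgc : double_continuous_on g a b)
    (hfd : double_differentiable_on f a b)
    (hgd : double_differentiable_on g a b) :
  exists c : point, open_rect a b c /\
    double_derivative f c * double_difference g a b =
    double_derivative g c * double_difference f a b.
Proof.
set (k := double_difference g a b); set (l := double_difference f a b).
destruct (nested_rectangles (fun p q => combined_difference f g k l p q = 0) a b hab)
  as [c [hc Hc]].
{ unfold combined_difference; fold k l; ring. }
{ intros p q pq ap qb Z.
  exact (interior_zero_double_difference f g k l a b p q hfc hgc ap qb pq Z). }
exists c; split; [exact hc |].
assert (Df := double_derivative_correct f c (hfd c hc)).
assert (Dg := double_derivative_correct g c (hgd c hc)).
set (f' := double_derivative f c) in *; set (g' := double_derivative g c) in *.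
enough (E : Rabs (k * f' - l * g') = 0).
{ assert (k * f' - l * g' = 0) by now apply Rabs_eq_0. lra. }
apply Rle_antisym; [| apply Rabs_pos].
apply le_epsilon; intros e he; rewrite Rplus_0_l.
(* The errors are weighted by [Rabs k] and [Rabs l], so tolerance [e / K] gives at most [e] in
   total; the added 1 keeps [K] positive. *)
set (K := Rabs k + Rabs l + 1).
assert (hk := Rabs_pos k); assert (hl := Rabs_pos l).
assert (he' : 0 < e / K) by (apply Rdiv_lt_0_compat; unfold K; lra).
destruct (double_difference_straddle_estimate f c f' (e / K) Df he') as [d1 [hd1 H1]].
destruct (double_difference_straddle_estimate g c g' (e / K) Dg he') as [d2 [hd2 H2]].
destruct (Hc (Rmin d1 d2)) as [p [q [hpq [Z [w1 w2]]]]]; [now apply Rmin_glb_lt |].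
assert (Rmin d1 d2 <= d1) by apply Rmin_l. assert (Rmin d1 d2 <= d2) by apply Rmin_r.
specialize (H1 p q hpq ltac:(lra) ltac:(lra)).
specialize (H2 p q hpq ltac:(lra) ltac:(lra)).
set (m := (fst q - fst p) * (snd q - snd p)) in *.
assert (hm : 0 < m).
{ destruct hpq as [[? ?] [? ?]]; apply Rmult_lt_0_compat; lra. }
unfold combined_difference in Z.
apply (Rmult_le_reg_r m); [exact hm |].
rewrite <- (Rabs_pos_eq m) at 1 by lra. rewrite <- Rabs_mult.
(* By [Z] the double differences cancel, leaving only the two approximation errors. *)
replace ((k * f' - l * g') * m) with
  (l * (double_difference g p q - g' * m) + - (k * (double_difference f p q - f' * m)))
  by lra.
apply Rle_trans with (1 := Rabs_triang _ _).
rewrite Rabs_Ropp, !Rabs_mult.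
apply (Rmult_le_compat_l (Rabs k)) in H1; [| exact hk].
apply (Rmult_le_compat_l (Rabs l)) in H2; [| exact hl].
assert (hem : 0 < e / K * m) by now apply Rmult_lt_0_compat.
replace (e * m) with (K * (e / K * m)) by (field; unfold K; lra).
set (r := e / K * m) in *; unfold K; lra.
Qed.
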